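(* Consider an uncertain Markov decision process with finite horizon $T$ in which the parameters $(p_t,r_t)\in\mathcal{U}_{s_t}$ realized at decision stage $t$ are random, $t=1,\dots,T$. Suppose the amounts of parameter deviation $b(p_t,r_t,p_t^0,r_t^0,\mathcal{U}_{s_t})$, $t=1,\dots,T$, are independent random variables, the $t$-th having mean $\alpha_t$. Let $\delta\in(0,1)$. Then with probability at least $1-\delta$ the total amount of deviation satisfies $$\sum_{t=1}^{T}b(p_t,r_t,p_t^0,r_t^0,\mathcal{U}_{s_t})\ \le\ \sum_{t=1}^{T}\alpha_t+\frac13\log(1/\delta)\left(1+\sqrt{1+18\,\frac{\sum_{t=1}^{T}\alpha_t}{\log(1/\delta)}}\right).$$
   Context: The MDP has finite state space $\mathcal{S}$ and finite action space $\mathcal{A}$. For each state $s$, $(p_s^0,r_s^0)$ are the nominal transition probabilities and rewards of $s$, belonging to an uncertainty set $\mathcal{U}_s$ of possible parameter values of $s$; $\mathcal{U}_s$ is star-shaped with respect to $(p_s^0,r_s^0)$, i.e. for every $u\in\mathcal{U}_s$ the line segment between $u$ and $(p_s^0,r_s^0)$ is contained in $\mathcal{U}_s$. At decision stage $t$ the system is in a (random) state $s_t$; $(p_t,r_t)\in\mathcal{U}_{s_t}$ are the parameters of $s_t$ realized at stage $t$, and $(p_t^0,r_t^0)=(p_{s_t}^0,r_{s_t}^0)$ the nominal ones. For an uncertainty set $\mathcal{U}$ containing nominal parameters $(p^0,r^0)$ and for $(p,r)\in\mathcal{U}$, the consumed budget (amount) of deviation is $$b(p,r,p^0,r^0,\mathcal{U})=\min\{\alpha\ge0\mid\exists(\delta_p,\delta_r)\in\Delta\mathcal{U}:\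 (p,r)=(p^0+\alpha\delta_p,\ r^0+\alpha\delta_r)\},$$ where $\Delta\mathcal{U}=\{(\delta_p,\delta_r)\mid(p^0+\delta_p,r^0+\delta_r)\in\mathcal{U}\}$. $\log$ is the natural logarithm. *)

(* Defs.v *)
From mathcomp Require Import all_boot all_order all_algebra.
From mathcomp Require Import all_classical all_reals all_analysis.

Set Implicit Arguments.
Unset Strict Implicit.
Unset Printing Implicit Defensive.

Import Order.TTheory GRing.Theory Num.Theory.
Import numFieldNormedType.Exports.

Local Open Scope classical_set_scope.
Local Open Scope ring_scope.

(* The parameters (p, r) of one state: p (a, x) is the probability of moving to
   x under action a, and r a is the reward of action a. *)
Notation params R S A :=
  ({ffun (A : finType) * (S : finType) -> (R : realType)^o} * {ffun A -> R^o})%type.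

Definition stochastic (R : realType) (S A : finType)
    (p : {ffun A * S -> R^o}) : Prop :=
  forall a, (forall x, 0 <= p (a, x)) /\ \sum_(x : S) p (a, x) = 1.

Definition star_shaped (R : realType) (V : lmodType R) (U : set V) (u0 : V)
    : Prop :=
  forall u, U u -> forall l : R, 0 <= l <= 1 -> U (u0 + l *: (u - u0)).

Definition deviations (R : realType) (V : lmodType R) (U : set V) (u0 : V)
    : set V :=
  [set du | U (u0 + du)].

Definition deviation_levels (R : realType) (V : lmodType R) (U : set V)
    (u0 u : V) : set R :=
  [set alpha | 0 <= alpha /\
     exists2 du, deviations U u0 du & u = u0 + alpha *: du].

(* The minimum of [deviation_levels] need not be attained when U is not closed;
   the infimum is the minimum whenever the latter exists
   ([deviation_amount_min]). *)
Definition deviation_amount (R : realType) (V : lmodType R) (U : set V)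
    (u0 u : V) : R :=
  inf (deviation_levels U u0 u).

Lemma deviation_amount_min (R : realType) (V : lmodType R) (U : set V)
    (u0 u : V) (alpha : R) :
  deviation_levels U u0 u alpha ->
  (forall beta, deviation_levels U u0 u beta -> alpha <= beta) ->
  deviation_amount U u0 u = alpha.
Proof.
move=> Ha Hmin; apply/eqP; rewrite eq_le; apply/andP; split.
  by apply: ge_inf => //; exists 0 => b [].
by apply: lb_le_inf; [exists alpha | exact: Hmin].
Qed.

Record uncertain_mdp (R : realType) (S A : finType) := UncertainMDP {
  nominal : S -> params R S A ;
  uncertainty_set : S -> set (params R S A) ;
  nominal_in : forall s, uncertainty_set s (nominal s) ;
  uncertainty_set_stochastic :
    forall s u, uncertainty_set s u -> stochastic u.1 ;
  uncertainty_set_star :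
    forall s, star_shaped (uncertainty_set s) (nominal s)
}.

(* The elementary events describing the state, the action and the realized
   parameters of one stage. *)
Definition stage_events (R : realType) (S A : finType) (Omega : Type)
    (st : Omega -> S) (ac : Omega -> A) (par : Omega -> params R S A)
    : set (set Omega) :=
  [set E | [\/ exists x, E = [set w | st w = x],
               exists a, E = [set w | ac w = a],
               exists a x B, measurable (B : set R) /\
                 E = [set w | B ((par w).1 (a, x))] |
               exists a B, measurable (B : set R) /\
                 E = [set w | B ((par w).2 a)]]].

(* A random trajectory of the uncertain MDP over T stages (numbered from 0).
   The decision maker's policy and nature's choice of the parameters may be
   randomized and may depend on the past; only the transitions are prescribed:
   given the whole history up to stage t, the next state has law
   p_t (a_t, -), in the sense of conditional probabilities given the
   sigma-algebra generated by the history. *)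
Record trajectory (R : realType) (S A : finType) (M : uncertain_mdp R S A)
    (d : measure_display) (Omega : measurableType d) (P : probability Omega R)
    (T : nat) := Trajectory {
  state : 'I_T -> Omega -> S ;
  action : 'I_T -> Omega -> A ;
  realized : 'I_T -> Omega -> params R S A ;
  stage_measurable : forall t : 'I_T,
    stage_events (state t) (action t) (realized t) `<=` measurable ;
  realized_in : forall (t : 'I_T) (w : Omega),
    uncertainty_set M (state t w) (realized t w) ;
  transition : forall t t' : 'I_T, t' = t.+1 :> nat ->
    forall (x : S) (H : set Omega),
    <<s [set E | exists2 i : 'I_T, (i <= t)%N &
                   stage_events (state i) (action i) (realized i) E] >> H ->
    P (H `&` [set w | state t' w = x]) =
    (\int[P]_(w in H) ((realized t w).1 (action t w, x))%:E)%E
}.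

(* b(p_t, r_t, p_t^0, r_t^0, U_{s_t}) as a function of the outcome. *)
Definition stage_deviation (R : realType) (S A : finType)
    (M : uncertain_mdp R S A) (d : measure_display) (Omega : measurableType d)
    (P : probability Omega R) (T : nat) (X : trajectory M P T)
    (t : 'I_T) (w : Omega) : R :=
  deviation_amount (uncertainty_set M (state X t w)) (nominal M (state X t w))
    (realized X t w).

Definition mutually_independent (R : realType) (d : measure_display)
    (Omega : measurableType d) (P : probability Omega R) (I : finType)
    (Y : I -> Omega -> R) : Prop :=
  forall (J : {set I}) (B : I -> set R), (forall i, measurable (B i)) ->
    P (\bigcap_(i in [set` J]) (Y i @^-1` B i)) =
    (\prod_(i in J) P (Y i @^-1` B i))%E.

(* Main.v *)
(* Each amount of deviation lies in [0, 1], so by convexity of the exponential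
   its moment generating function at l is at most exp (alpha_t (exp l - 1)).
   A Chernoff bound then gives a tail of at most
   exp (a (exp l - 1) - l (a + x)) with a the sum of the alpha_t, and Bernstein's
   estimate exp l - 1 - l <= (l^2 / 2) / (1 - l / 3) with l = x / (a + x / 3)
   bounds this by exp (- x^2 / (2 (a + x / 3))); the deviation x of the theorem is
   the positive root of x^2 = 2 (a + x / 3) log (1 / delta).
   Independence is used only through finite sums: the variables are rounded down
   to multiples of 1/n, which costs a factor exp (l T / n), and n tends to
   infinity. *)
Require Import Defs.
From HB Require Import structures.
From mathcomp Require Import all_boot all_order all_algebra.
From mathcomp Require Import all_classical all_reals all_analysis.
From mathcomp Require Import measurable_realfun ring lra.

Import Order.TTheory GRing.Theory Num.Theory.
Import numFieldNormedType.Exports.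

Local Open Scope classical_set_scope.
Local Open Scope ring_scope.

(** * Range of the amount of deviation *)

Lemma deviation_amount_itv {R : realType} {V : lmodType R} (U : set V)
    (u0 u : V) : U u -> 0 <= deviation_amount U u0 u <= 1.
Proof.
(* The level 1 is always admissible, with the deviation [u - u0]. *)
move=> Uu; have L1 : deviation_levels U u0 u 1.
  split=> //; exists (u - u0); last by rewrite scale1r subrKC.
  by rewrite /deviations /= subrKC.
apply/andP; split; first by apply: lb_le_inf; [exists 1 | move=> b []].
by apply: ge_inf => //; exists 0 => b [].
Qed.

(** * Estimates for the exponential function *)

Lemma leq_exp3_fact k : (2 * 3 ^ k <= (k.+2)`!)%N.
Proof. by elim: k => // k IH; rewrite factS expnS mulnCA leq_mul. Qed.

(** From degree 2 on, the exponential series is dominated termwise by the geometric series with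
    first term [x ^+ 2 / 2] and ratio [x / 3], because (k+2)! is at least 2 * 3^k. *)
Lemma expR_le_bernstein (R : realType) (x : R) : 0 <= x < 3 ->
  expR x <= 1 + x + x ^+ 2 / 2 / (1 - x / 3).
Proof.
move=> /andP[x0 x3].
have q1 : 0 < 1 - x / 3 by lra.
(* The second summand is the tail of the geometric series from index [n] on; keeping it makes the
   bound inductive. *)
have key n : series (exp_coeff x) n.+2 +
    x ^+ 2 / 2 / (1 - x / 3) * (x / 3) ^+ n <=
    1 + x + x ^+ 2 / 2 / (1 - x / 3).
  elim: n => [|n IH].
    rewrite /series /= 2?big_nat_recr//= big_geq// /exp_coeff /= expr0 expr1.
    by rewrite !fact0 !divr1 add0r mulr1.
  apply: le_trans IH; rewrite [series _ n.+3]/series /= big_nat_recr//=.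
  rewrite -/(series _ _) -addrA lerD2l.
  have -> : x ^+ 2 / 2 / (1 - x / 3) * (x / 3) ^+ n =
      x ^+ 2 / 2 * (x / 3) ^+ n + x ^+ 2 / 2 / (1 - x / 3) * (x / 3) ^+ n.+1.
    by rewrite [(x / 3) ^+ n.+1]exprS; field; rewrite gt_eqF//; lra.
  rewrite lerD2r /exp_coeff /= mulrC.
  have -> : x ^+ 2 / 2 * (x / 3) ^+ n = (2 * 3 ^+ n)^-1 * x ^+ n.+2.
    rewrite expr_div_n -(addn2 n) [x ^+ (n + 2)]exprD; field.
    by rewrite expf_neq0.
  rewrite ler_wpM2r ?exprn_ge0// lef_pV2 ?posrE ?ltr0n ?fact_gt0//.
  by rewrite -natrX -natrM ler_nat leq_exp3_fact.
apply: limr_le; first exact: is_cvg_series_exp_coeff.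
exists 2%N => // -[|[|n]] //= _; apply: le_trans (key n).
by rewrite lerDl mulr_ge0 ?exprn_ge0 ?divr_ge0 ?exprn_ge0 ?(ltW q1).
Qed.

(** By convexity the graph of exp lies below its chord between 0 and [l], evaluated at [l * y]. *)
Lemma expR_chord (R : realType) (l y : R) : 0 <= y <= 1 ->
  expR (l * y) <= 1 + y * (expR l - 1).
Proof.
move=> /andP[y0 y1].
have : expR (y * l + (1 - y) * 0) <= y * expR l + (1 - y) * expR 0.
  by have := @convex_expR R (Itv01 y0 y1) l 0; rewrite !convRE.
rewrite expR0 mulr0 addr0 mulr1 mulrC => /le_trans; apply; lra.
Qed.

Lemma bernstein_exponent (R : realType) (a L : R) : 0 <= a -> 0 < L ->
  exists2 l, 0 <= l & a * (expR l - 1) -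
    l * (a + 1 / 3 * L * (1 + Num.sqrt (1 + 18 * (a / L)))) <= - L.
Proof.
move=> a0 L0; set s := Num.sqrt _; set x := 1 / 3 * L * (1 + s).
have s0 : 0 <= s by exact: sqrtr_ge0.
have aL0 : 0 <= a / L by rewrite divr_ge0// ltW.
have s2 : s ^+ 2 = 1 + 18 * (a / L) by rewrite sqr_sqrtr//; lra.
have x2 : x ^+ 2 = 2 * L * (a + x / 3).
  have -> : x ^+ 2 = L ^+ 2 / 9 * (1 + 2 * s + s ^+ 2) by rewrite /x; field.
  by rewrite s2 /x; field; rewrite gt_eqF.
have x0 : 0 < x by rewrite /x mulr_gt0 ?mulr_gt0 ?divr_gt0//; lra.
have d0 : 0 < a + x / 3 by lra.
exists (x / (a + x / 3)); first by rewrite divr_ge0// ltW.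
set l := x / _.
have lx : l * x = 2 * L.
  by rewrite /l mulrAC -expr2 x2 mulfK// gt_eqF.
(* For [a = 0] the choice gives [l = 3], outside the range of Bernstein's estimate, but the exponent
   is then just [- l * x = - 2 * L]. *)
have [a_eq0|a_neq0] := eqVneq a 0; first by rewrite a_eq0 mul0r !add0r lx; lra.
have a_gt0 : 0 < a by rewrite lt_neqAle eq_sym a_neq0.
have l3 : 0 <= l < 3.
  rewrite divr_ge0 ?ltW//= ltr_pdivrMr//; lra.
have := expR_le_bernstein _ _ l3.
(* After multiplication by [a] the Bernstein term is exactly [L], half of [l * x], so the exponent
   is at most [L - 2 * L]. *)
have -> : l ^+ 2 / 2 / (1 - l / 3) = L / a.
  have -> : 1 - l / 3 = a / (a + x / 3).
    by rewrite /l; field; rewrite gt_eqF//; lra.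
  have -> : l ^+ 2 = 2 * L / (a + x / 3).
    by rewrite expr2 -lx [in RHS]/l mulrA.
  by field; rewrite a_neq0/= gt_eqF//; lra.
rewrite -(ler_pM2l a_gt0) => h.
have : a * (1 + l + L / a) = a + a * l + L by field.
lra.
Qed.

(** * Step functions and rounding down to multiples of 1/n *)

Lemma integral_sum_indic {R : realType} {d} {Omega : measurableType d}
    (P : probability Omega R) (J : finType) (c : J -> R) (E : J -> set Omega) :
  (forall j, 0 <= c j) -> (forall j, measurable (E j)) ->
  (\int[P]_w (\sum_j c j * \1_(E j) w)%:E = \sum_j (c j)%:E * P (E j))%E.
Proof.
move=> c0 mE.
under eq_integral do rewrite -sumEFin.
rewrite ge0_integral_sum//.
- apply: eq_bigr => j _.
  under eq_integral do rewrite EFinM.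
  rewrite ge0_integralZl//.
  + by rewrite integral_indic// setIT.
  + by apply/measurable_EFinP.
  + by rewrite lee_fin.
- by move=> j; apply/measurable_EFinP; exact: measurable_funM.
- by move=> j w _; rewrite lee_fin mulr_ge0.
Qed.

(** Half-open intervals, so that for positive [n] the cells are disjoint. The value 1 lies in the
    cell of index [n], hence covering [0, 1] takes [n.+1] cells. *)
Definition cell {R : realType} (n k : nat) : set R :=
  [set` `[k%:R / n%:R, k.+1%:R / n%:R[%R].

Lemma measurable_cell {R : realType} n k : measurable (cell n k : set R).
Proof. exact: measurable_itv. Qed.

Lemma cell_truncn {R : realType} n k (y : R) : (0 < n)%N ->
  cell n k y -> k = Num.truncn (n%:R * y).
Proof.
move=> n0; rewrite /cell /= in_itv/= => /andP[lo hi]; apply/esym/truncn_def.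
by rewrite mulrC -ler_pdivrMr ?ltr0n// -ltr_pdivlMr ?ltr0n// lo.
Qed.

Lemma truncn_cell {R : realType} n (y : R) : (0 < n)%N -> 0 <= y ->
  cell n (Num.truncn (n%:R * y)) y.
Proof.
move=> n0 y0; have /andP[lo hi] := truncn_itv (mulr_ge0 (ler0n R n) y0).
rewrite /cell /= in_itv/= ler_pdivrMr ?ltr0n// ltr_pdivlMr ?ltr0n//.
by rewrite [y * _]mulrC lo.
Qed.

(** At most one term is nonzero: the one where [y] is replaced by its rounding down to a multiple of
    1/n. *)
Lemma sum_indic_cell_le (R : realType) n (l y : R) : (0 < n)%N -> 0 <= l ->
  \sum_(k < n.+1) expR (l * (k%:R / n%:R)) * \1_(cell n k) y <= expR (l * y).
Proof.
move=> n0 l0.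
have [[k yk]|nk] := pselect (exists k : 'I_n.+1, cell n k y); last first.
  rewrite big1 ?expR_ge0// => k _; rewrite indicE memNset ?mulr0// => yk.
  by apply: nk; exists k.
rewrite (bigD1 k)//= big1 ?addr0 => [|j jk].
  rewrite indicE mem_set// mulr1 ler_expR ler_wpM2l//.
  by move: yk; rewrite /cell /= in_itv/= => /andP[].
rewrite indicE memNset ?mulr0// => yj; case/eqP: jk; apply/val_inj => /=.
by rewrite (cell_truncn _ _ _ n0 yj) (cell_truncn _ _ _ n0 yk).
Qed.

(** * Chernoff bound for independent variables in [0, 1] *)

Section chernoff.
Context {R : realType} {d : measure_display} {Omega : measurableType d}.
Variables (P : probability Omega R) (I : finType) (Y : I -> Omega -> R).
Variable alpha : I -> R.
Hypothesis mY : forall i, measurable_fun setT (Y i).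
Hypothesis Y01 : forall i w, 0 <= Y i w <= 1.
Hypothesis Y_indep : mutually_independent P Y.
Hypothesis Y_mean : forall i, ('E_P[Y i] = (alpha i)%:E)%E.

Let measurable_preimage_cell i n k : measurable (Y i @^-1` cell n k).
Proof.
by rewrite -[X in measurable X]setTI; apply: mY => //; exact: measurable_cell.
Qed.

Let pcell n i k := fine (P (Y i @^-1` cell n k)).

Let pcellE n i k : P (Y i @^-1` cell n k) = (pcell n i k)%:E.
Proof. by rewrite fineK// fin_num_measure. Qed.

Lemma mean_ge0 i : 0 <= alpha i.
Proof.
by rewrite -lee_fin -Y_mean expectation_ge0// => w; case/andP: (Y01 i w).
Qed.

(** The left side is the moment generating function of the rounded variable. Rounding down only
    decreases it, the chord bound makes it affine in the mean, and 1 + z <= exp z concludes. *)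
Lemma sum_pcell_le i n (l : R) : (0 < n)%N -> 0 <= l ->
  \sum_(k < n.+1) expR (l * (k%:R / n%:R)) * pcell n i k <=
  expR (alpha i * (expR l - 1)).
Proof.
move=> n0 l0; have el0 : 0 <= expR l - 1 by rewrite subr_ge0 -expR0 ler_expR.
apply: (@le_trans _ _ (1 + alpha i * (expR l - 1))); last exact: expR_ge1Dx.
rewrite -lee_fin -sumEFin.
under eq_bigr do rewrite EFinM -pcellE.
rewrite -(integral_sum_indic P _ (fun k : 'I_n.+1 => expR (l * (k%:R / n%:R)))
  (fun k => Y i @^-1` cell n k)) => [|k|k]; first last.
- exact: measurable_preimage_cell.
- exact: expR_ge0.
apply: (@le_trans _ _ (\int[P]_w (1 + (expR l - 1)%:E * (Y i w)%:E)%E)%E).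
  apply: ge0_le_integral => //.
  - move=> w _; rewrite lee_fin; apply: sumr_ge0 => k _.
    by apply: mulr_ge0; [exact: expR_ge0|rewrite indicE].
  - apply/measurable_EFinP; apply: measurable_sum => k.
    apply: measurable_funM => //.
  - apply: emeasurable_funD => //; apply/measurable_EFinP.
    exact: measurable_funM.
  - move=> w _; rewrite -EFinM -EFinD lee_fin.
    apply: (le_trans (sum_indic_cell_le _ n l (Y i w) n0 l0)).
    by rewrite [(expR l - 1) * _]mulrC expR_chord.
rewrite ge0_integralD//.
- have -> : (\int[P]_(_ in setT) 1 = 1)%E.
    by rewrite integral_cst// mul1e; exact: probability_setT.
  rewrite ge0_integralZl//.
  + by have := Y_mean i; rewrite unlock => ->; rewrite mulrC.
  + by apply/measurable_EFinP.
  + by move=> w _; rewrite lee_fin; case/andP: (Y01 i w).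
- by move=> w _; rewrite -EFinM lee_fin mulr_ge0//; case/andP: (Y01 i w).
- by apply/measurable_EFinP; exact: measurable_funM.
Qed.

Lemma chernoff_cell n (l b : R) : (0 < n)%N -> 0 <= l ->
  (P [set w | (b < \sum_i Y i w)%R] <=
   (expR ((\sum_i alpha i) * (expR l - 1) - l * b + l * #|I|%:R / n%:R))%:E)%E.
Proof.
move=> n0 l0.
pose E (f : {ffun I -> 'I_n.+1}) :=
  \bigcap_(i in [set` [set: I]%SET]) (Y i @^-1` cell n (f i)).
have mE f : measurable (E f).
  by apply: fin_bigcap_measurable => // i _; exact: measurable_preimage_cell.
(* This is the exponential of [l] times (rounded sum + [#|I|] / n - [b]), which is at least 1
   whenever the joint cell [E f] meets the bad event. *)
pose c (f : {ffun I -> 'I_n.+1}) :=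
  expR (l * #|I|%:R / n%:R - l * b) * \prod_i expR (l * ((f i)%:R / n%:R)).
have c0 f : 0 <= c f.
  by rewrite mulr_ge0 ?expR_ge0// prodr_ge0// => i _; exact: expR_ge0.
have mbad : measurable [set w | b < \sum_i Y i w].
  rewrite -[X in measurable X]setTI.
  rewrite (_ : [set w | _] = (fun w => \sum_i Y i w) @^-1` `]b, +oo[%classic).
    by apply: measurable_sum => //.
  by apply/seteqP; split => w /=; rewrite in_itv/= andbT.
(* Markov's inequality in discrete form: the indicator of the bad event is dominated by the step
   function with values [c f]. *)
apply: (@le_trans _ _ (\int[P]_w (\sum_f c f * \1_(E f) w)%:E)%E).
  rewrite -[X in P X]setIT -integral_indic//.
  apply: ge0_le_integral => //.
  - by apply/measurable_EFinP.
  - apply/measurable_EFinP; apply: measurable_sum => f.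
    exact: measurable_funM.
  - move=> w _; rewrite lee_fin [leLHS]indicE.
    have nneg f : 0 <= c f * \1_(E f) w by rewrite mulr_ge0// indicE.
    have [bad|_] := boolP (w \in _); last by rewrite sumr_ge0.
    move: bad; rewrite inE /= => bad.
    have tr i : (Num.truncn (n%:R * Y i w) < n.+1)%N.
      case/andP: (Y01 i w) => y0 y1; rewrite ltnS truncn_le_nat.
      by rewrite (le_lt_trans (ler_piMr _ y1))// ltr_nat.
    pose f : {ffun I -> 'I_n.+1} := [ffun i => Ordinal (tr i)].
    have cellf i : cell n (f i) (Y i w).
      by rewrite ffunE /=; apply: truncn_cell => //; case/andP: (Y01 i w).
    rewrite (bigD1 f)//= -[leLHS]addr0 lerD ?sumr_ge0//.
    rewrite indicE mem_set ?mulr1; last by move=> i _; exact: cellf.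
    rewrite /c -expR_sum -expRD -[leLHS]expR0 ler_expR -mulr_sumr -mulrA.
    rewrite -mulrBr -mulrDr mulr_ge0//.
    (* Each variable loses at most 1/n by rounding. *)
    suff : \sum_i Y i w <= \sum_i ((f i)%:R / n%:R) + #|I|%:R / n%:R by lra.
    rewrite -[#|I|]sum1_card natr_sum mulr_suml -big_split/=.
    apply: ler_sum => i _; move: (cellf i); rewrite /cell /= in_itv/=.
    by case/andP => _ /ltW; rewrite -natr1 mulrDl.
rewrite integral_sum_indic//.
have termE f : ((c f)%:E * P (E f) =
    (expR (l * #|I|%:R / n%:R - l * b) *
     \prod_i (expR (l * ((f i)%:R / n%:R)) * pcell n i (f i)))%:E)%E.
  rewrite /E Y_indep => [|i]; last exact: measurable_cell.
  rewrite [in LHS](eq_bigl xpredT) => [|i]; last by rewrite inE.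
  under eq_bigr do rewrite pcellE.
  by rewrite prodEFin -EFinM big_split/= mulrA.
under eq_bigr do rewrite termE.
rewrite sumEFin lee_fin -mulr_sumr.
(* Independence has turned each term into a product over [I], so the sum over all [f] factors into a
   product of one-variable sums. *)
rewrite -(bigA_distr_bigA
  (fun i (k : 'I_n.+1) => expR (l * (k%:R / n%:R)) * pcell n i k)).
rewrite [X in _ <= expR X](_ : _ = l * #|I|%:R / n%:R - l * b +
  \sum_i alpha i * (expR l - 1)); last by rewrite -mulr_suml; ring.
rewrite [leRHS]expRD expR_sum ler_wpM2l ?expR_ge0//.
apply: ler_prod => i _; rewrite sum_pcell_le// andbT sumr_ge0// => k _.
by rewrite mulr_ge0 ?expR_ge0// fine_ge0.
Qed.

Lemma chernoff (l b : R) : 0 <= l ->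
  (P [set w | (b < \sum_i Y i w)%R] <=
   (expR ((\sum_i alpha i) * (expR l - 1) - l * b))%:E)%E.
Proof.
move=> l0; set bad := [set w | _]; set v := _ - l * b.
have Pfin : P bad = (fine (P bad))%:E.
  rewrite fineK// ge0_fin_numE//.
  apply: (le_lt_trans (chernoff_cell 1 l b _ l0)) => //.
  by rewrite ltry.
set p := fine _ in Pfin; rewrite Pfin lee_fin.
have [|p0] := leP p 0; first by move/le_trans; apply; exact: expR_ge0.
(* Between logarithms the rounding error is additive, and a large [n] makes it at most any given
   [e]. *)
rewrite -[leLHS]lnK ?posrE// ler_expR; apply/ler_addgt0Pr => e e0.
have [n [n0 hn]] : exists n, (0 < n)%N /\ l * #|I|%:R / n%:R <= e.
  exists (Num.truncn (l * #|I|%:R / e)).+1; split => //.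
  by rewrite ler_pdivrMr// [e * _]mulrC -ler_pdivrMr// ltW// truncnS_gt.
have := chernoff_cell n l b n0 l0; rewrite Pfin lee_fin => h.
rewrite -ler_expR lnK ?posrE//; apply: (le_trans h).
by rewrite ler_expR lerD2l.
Qed.

End chernoff.

(** * Tail bound for the total amount of deviation *)

Theorem theorem6 (R : realType) (S A : finType) (M : uncertain_mdp R S A)
    (d : measure_display) (Omega : measurableType d) (P : probability Omega R)
    (T : nat) (X : trajectory M P T) (alpha : 'I_T -> R) (delta : R)
    (dev_measurable : forall t : 'I_T, measurable_fun setT (stage_deviation X t))
    (dev_independent : mutually_independent P (stage_deviation X))
    (dev_mean : forall t : 'I_T, 'E_P[stage_deviation X t]%E = (alpha t)%:E)
    (hdelta : 0 < delta < 1) :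
  ((1 - delta)%:E <=
   P [set w | \sum_(t < T) stage_deviation X t w <=
       \sum_(t < T) alpha t +
       1 / 3 * ln (1 / delta) *
         (1 + Num.sqrt (1 + 18 * ((\sum_(t < T) alpha t) / ln (1 / delta))))]%R)%E.
Proof.
case/andP: hdelta => delta0 delta1.
have dev01 t w : 0 <= stage_deviation X t w <= 1.
  by apply: deviation_amount_itv; exact: realized_in.
set b := \sum_(t < T) alpha t + _.
have L0 : 0 < ln (1 / delta) by rewrite ln_gt0// div1r invf_gt1.
have a0 : 0 <= \sum_(t < T) alpha t.
  by apply: sumr_ge0 => t _; exact: (mean_ge0 P _ (stage_deviation X)).
have [l l0 hl] := bernstein_exponent _ _ _ a0 L0.
have bad :
    (P [set w | (b < \sum_(t < T) stage_deviation X t w)%R] <= delta%:E)%E.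
  apply: (le_trans (chernoff P _ _ alpha dev_measurable dev01 dev_independent
    dev_mean l b l0)).
  rewrite lee_fin -[leRHS]lnK ?posrE// ler_expR (le_trans hl)//.
  by rewrite div1r lnV ?posrE// opprK.
set good := [set w | _]; have mgood : measurable good.
  rewrite -[good]setTI.
  rewrite (_ : good = (fun w => \sum_(t < T) stage_deviation X t w) @^-1`
      `]-oo, b]%classic).
    by apply: measurable_sum => //.
  by apply/seteqP; split => w /=; rewrite in_itv.
(* The complement of the good event is the tail event bounded by [delta]. *)
rewrite -[good]setCK probability_setC; last exact: measurableC.
rewrite EFinB leeB//.
rewrite (_ : ~` good = [set w | (b < \sum_(t < T) stage_deviation X t w)%R])//.
by apply/seteqP; split => w /=; rewrite ltNge => /negP.
Qed.
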